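(* Let $n\ge 2$ be an integer and let $\mathcal V$ be a congruence $n$-permutable variety. Then $\mathcal V$ satisfies TImC if and only if $\mathcal V$ is congruence permutable.
   Context: A variety $\mathcal V$ is congruence $n$-permutable if for every $\mathbf A\in\mathcal V$ and all congruences $\alpha,\beta$ of $\mathbf A$ the $n$-fold alternating relational products coincide: $\alpha\circ\beta\circ\alpha\circ\cdots=\beta\circ\alpha\circ\beta\circ\cdots$ ($n$ factors on each side). It is congruence permutable if it is congruence $2$-permutable, i.e. $\alpha\circ\beta=\beta\circ\alpha$ always holds. A tolerance of an algebra $\mathbf A=(A;F)$ is a reflexive, symmetric relation $\tau\subseteq A^2$ compatible with all operations in $F$. If $\phi\colon\mathbf B\to\mathbf A$ is a homomorphism and $\vartheta\subseteq B^2$, write $\phi(\vartheta)=\{(\phi(a),\phi(b)):(a,b)\in\vartheta\}$. A variety $\mathcal V$ satisfies TImC (its tolerances are homomorphic images of its congruences) if for every $\mathbf A\in\mathcal V$ and every tolerance $\tau$ of $\mathbf A$ there exist an algebra $\mathbf B\in\mathcal V$, a congruence $\vartheta$ of $\mathbf B$, and a homomorphism $\phi\colon\mathbf B\to\mathbf A$ such that $\tau=\phi(\vartheta)$. *)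

(* Defs.v *)
(* Universal algebra over a finitary signature, on top of MathComp. *)
From mathcomp Require Import all_boot.
From Corelib Require Import Relation_Definitions RelationClasses.
From Stdlib Require Import ClassicalEpsilon.

Set Implicit Arguments.
Unset Strict Implicit.
Unset Printing Implicit Defensive.

Record signature := Signature { symbol : Type; arity : symbol -> nat }.

(* Algebras are nonempty, as usual in universal algebra. *)
Record algebra (S : signature) := Algebra {
  carrier :> Type;
  app : forall f : symbol S, ('I_(arity f) -> carrier) -> carrier;
  carrier_inhabited : inhabited carrier }.

Arguments app {S} A f a : rename.

Definition is_hom (S : signature) (A B : algebra S) (phi : A -> B) : Prop :=
  forall (f : symbol S) (a : 'I_(arity f) -> A),
    phi (app A f a) = app B f (fun i => phi (a i)).

Definition surjective (X Y : Type) (phi : X -> Y) : Prop :=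
  forall y, exists x, phi x = y.

Lemma product_inhabited (S : signature) (I : Type) (A : I -> algebra S) :
  inhabited (forall i, A i).
Proof.
exact: (inhabits (fun i => epsilon (carrier_inhabited (A i)) (fun=> True))).
Qed.

Definition product (S : signature) (I : Type) (A : I -> algebra S) :
    algebra S :=
  @Algebra S (forall i, A i) (fun f a i => app (A i) f (fun j => a j i))
    (product_inhabited A).

(* Closure under H, S and P. A subalgebra is given, up to isomorphism, by an
   injective homomorphism. The index type I may be empty, so a variety contains
   the one-element algebras and is a nonempty class. *)
Record is_variety (S : signature) (V : algebra S -> Prop) : Prop := IsVariety {
  variety_H : forall (A B : algebra S) (phi : A -> B),
    is_hom phi -> surjective phi -> V A -> V B;
  variety_S : forall (A B : algebra S) (phi : B -> A),
    is_hom phi -> injective phi -> V A -> V B;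
  variety_P : forall (I : Type) (A : I -> algebra S),
    (forall i, V (A i)) -> V (product A) }.

Definition compatible (S : signature) (A : algebra S) (R : relation A) : Prop :=
  forall (f : symbol S) (a b : 'I_(arity f) -> A),
    (forall i, R (a i) (b i)) -> R (app A f a) (app A f b).

Definition is_congruence (S : signature) (A : algebra S) (R : relation A) :
    Prop :=
  Equivalence R /\ compatible R.

Definition is_tolerance (S : signature) (A : algebra S) (R : relation A) :
    Prop :=
  [/\ Reflexive R, Symmetric R & compatible R].

Definition rel_comp (X : Type) (R T : relation X) : relation X :=
  fun x z => exists2 y, R x y & T y z.

(* R o T o R o ... with n factors; the product of 0 factors is the identity. *)
Fixpoint alt_comp (X : Type) (n : nat) (R T : relation X) : relation X :=
  if n is m.+1 then rel_comp R (alt_comp m T R) else eq.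

Definition rel_image (X Y : Type) (phi : X -> Y) (R : relation X) :
    relation Y :=
  fun y y' => exists x x', [/\ R x x', phi x = y & phi x' = y'].

Definition cong_n_permutable (S : signature) (n : nat)
    (V : algebra S -> Prop) : Prop :=
  forall A : algebra S, V A ->
  forall alpha beta : relation A, is_congruence alpha -> is_congruence beta ->
  forall x y, alt_comp n alpha beta x y <-> alt_comp n beta alpha x y.

Definition cong_permutable (S : signature) (V : algebra S -> Prop) : Prop :=
  cong_n_permutable 2 V.

Definition TImC (S : signature) (V : algebra S -> Prop) : Prop :=
  forall A : algebra S, V A ->
  forall tau : relation A, is_tolerance tau ->
  exists (B : algebra S) (theta : relation B) (phi : B -> A),
    [/\ V B, is_congruence theta, is_hom phi &
        forall a b, tau a b <-> rel_image phi theta a b].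

(* Main.v *)
Require Import Defs.
From mathcomp Require Import all_boot.
From Corelib Require Import Relation_Definitions RelationClasses.
From Stdlib Require Import FunctionalExtensionality Classical_Prop.

Set Implicit Arguments.
Unset Strict Implicit.
Unset Printing Implicit Defensive.

(** If congruences permute, every tolerance [tau] is already a congruence, so
    it is the image of itself under the identity. Regard [tau] as a subalgebra
    of the square of the algebra: if [tau a b] and [tau b c], then the pair
    [(a, b)] is linked to [(b, c)] through [(b, b)] by the two projection
    kernels, and permuting these kernels produces the pair [(a, c)] in [tau]
    ([permutable_compatible_transitive]).

    Conversely, suppose that tolerances are images of congruences and that
    congruences (2k+1)-permute; then they already (k+1)-permute, as follows.
    - Let [tau] be the image of [theta] under [phi], and [kappa] the kernel of
      [phi]. The power [tau^(k+1)] is the image of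
      [theta o kappa o ... o theta] with 2k+1 factors. Permuting turns this into
      [kappa o theta o ... o kappa], which has only k factors [theta]. Hence
      [tau^(k+1)] is contained in [tau^k] ([image_power_collapse]).
    - Apply this to [tau], the intersection of [alpha o beta] and
      [beta o alpha]. It is a tolerance containing [alpha] and [beta], so
      [alpha o beta o ...] with k+1 factors lies in [tau^(k+1)], hence in
      [tau^k]. In a product of k copies of [tau], expand the factors alternately
      as [beta o alpha] and [alpha o beta]: equal neighbours merge and only k+1
      factors [beta o alpha o ...] remain ([comp_meet_power_sub]).

    Since n-permutability passes to larger n and n+1 <= 2(n-1)+1 whenever
    2 <= n, this lowers any degree of permutability down to 2. *)

(** * Alternating products of relations *)

Section AlternatingProducts.
Variable X : Type.
Implicit Types R T : relation X.

Lemma alt_comp_mono n R T R' T' :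
    (forall x y, R x y -> R' x y) -> (forall x y, T x y -> T' x y) ->
  forall x y, alt_comp n R T x y -> alt_comp n R' T' x y.
Proof.
elim: n R T R' T' => [|n IHn] R T R' T' sR sT x y //= [z Rxz Tzy].
by exists z; [exact: sR | exact: IHn Tzy].
Qed.

Lemma alt_comp_absorb n R T x y z :
  Transitive R -> R x y -> alt_comp n.+1 R T y z -> alt_comp n.+1 R T x z.
Proof. by move=> trR Rxy [w Ryw Twz]; exists w => //; exact: trR Ryw. Qed.

Lemma alt_comp_extend n R T x y :
  Reflexive R -> Reflexive T -> alt_comp n R T x y -> alt_comp n.+1 R T x y.
Proof.
elim: n R T x => [|n IHn] R T x rR rT; first by move=> /= ->; exists y.
by case=> z Rxz Tzy; exists z => //; exact: IHn.
Qed.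

Definition comp_meet R T : relation X :=
  fun x y => rel_comp R T x y /\ rel_comp T R x y.

Lemma comp_meet_l R T x y : Reflexive T -> R x y -> comp_meet R T x y.
Proof. by move=> rT Rxy; split; [exists y | exists x]. Qed.

Lemma comp_meet_r R T x y : Reflexive R -> T x y -> comp_meet R T x y.
Proof. by move=> rR Txy; split; [exists x | exists y]. Qed.

(** The two conclusions support each other in the induction: to start with [R],
    the first factor [comp_meet R T] is read as [R o T], and its [T] merges
    with the leading [T] of the product obtained from the other factors. *)
Lemma comp_meet_power_sub n R T x y :
    Equivalence R -> Equivalence T ->
    alt_comp n (comp_meet R T) (comp_meet R T) x y ->
  alt_comp n.+1 R T x y /\ alt_comp n.+1 T R x y.
Proof.
move=> eR eT; elim: n x => [|n IHn] x.
  by move=> /= ->; split; exists y => //; reflexivity.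
case=> z [[u Rxu Tuz] [v Txv Rvz]] /IHn[Rzy Tzy]; split.
  by exists u => //; apply: alt_comp_absorb Tuz Tzy; case: eT.
by exists v => //; apply: alt_comp_absorb Rvz Rzy; case: eR.
Qed.

End AlternatingProducts.

(** * Congruences and tolerances *)

Lemma rel_comp_compatible (S : signature) (A : algebra S) (R T : relation A) :
  compatible R -> compatible T -> compatible (rel_comp R T).
Proof.
move=> cR cT f a b /fin_all_exists2[c Rac Tcb].
by exists (app A f c); [exact: cR | exact: cT].
Qed.

Lemma comp_meet_tolerance (S : signature) (A : algebra S) (R T : relation A) :
  is_congruence R -> is_congruence T -> is_tolerance (comp_meet R T).
Proof.
move=> [[rR sR _] cR] [[rT sT _] cT]; split.
- by move=> x; apply: comp_meet_l.
- move=> x y [[u Rxu Tuy] [v Txv Rvy]].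
  by split; [exists v | exists u]; (exact: sR) || exact: sT.
- move=> f a b Rab.
  by split; apply: rel_comp_compatible => // i; case: (Rab i).
Qed.

Lemma kernel_congruence (S : signature) (A B : algebra S) (phi : A -> B) :
  is_hom phi -> is_congruence (fun x y => phi x = phi y).
Proof.
move=> homphi; split; first by split=> // x y z -> ->.
move=> f a b eq_ab; rewrite !homphi.
by congr (app B f); apply: functional_extensionality.
Qed.

(** * Permutability and images of congruences *)

(** Permuting the tail of an (n+2)-fold product makes its first factor equal the
    factor before it; the two merge and n+1 factors remain. The index is n+1
    because the tail must have a first factor to merge. *)
Lemma cong_permutable_succ (S : signature) (V : algebra S -> Prop) n :
  cong_n_permutable n.+1 V -> cong_n_permutable n.+2 V.
Proof.
move=> perm A VA.
suff sub (alpha beta : relation A) x y : is_congruence alpha ->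
    is_congruence beta ->
  alt_comp n.+2 alpha beta x y -> alt_comp n.+2 beta alpha x y.
  by move=> alpha beta ca cb x y; split; exact: sub.
move=> ca cb [z axz bzy]; case: (ca) (cb) => [[ra _ ta] _] [[rb _ _] _].
apply: alt_comp_extend => //; apply/(perm A VA alpha beta) => //.
by apply: (alt_comp_absorb ta axz); apply/(perm A VA alpha beta).
Qed.

Lemma cong_permutable_leq (S : signature) (V : algebra S -> Prop) m n :
  0 < m <= n -> cong_n_permutable m V -> cong_n_permutable n V.
Proof.
case/andP=> m_gt0 le_mn perm; rewrite -(subnK le_mn); elim: (n - m) => //= d.
case: m m_gt0 {le_mn perm} => // m _; rewrite addSn addnS.
exact: cong_permutable_succ.
Qed.

Section Image.
Variables (X Y : Type) (phi : X -> Y) (theta : relation X).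
Let kappa : relation X := fun x y => phi x = phi y.
Let tau := rel_image phi theta.

(** The endpoints of consecutive [tau]-steps agree in [Y] only, so each junction
    of their lifts to [X] costs one factor [kappa]. *)
Lemma image_power_lift n y z : alt_comp n.+1 tau tau y z ->
  exists b c, [/\ phi b = y, phi c = z & alt_comp n.*2.+1 theta kappa b c].
Proof.
elim: n y => [|n IHn] y.
  by case=> _ [b [c [bc yb <-]]] <-; exists b, c; split=> //; exists c.
case=> _ [b [c [bc yb <-]]] /IHn[b' [d [cb' dz bd]]].
exists b, d; split=> //; rewrite doubleS.
by exists c => //; exists b'.
Qed.

Lemma image_power_push n b c :
  alt_comp n.*2.+1 kappa theta b c -> alt_comp n tau tau (phi b) (phi c).
Proof.
elim: n b => [|n IHn] b; first by case=> e be <-.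
rewrite doubleS => -[d bd [e de /IHn ec]].
by exists (phi e) => //; exists d, e; split.
Qed.

End Image.

(** Lifting n+1 steps of the image produces n+1 factors [theta] and n factors
    of the kernel of [phi]; permuting exchanges the two counts, and [phi] sends
    the kernel factors to equalities. *)
Lemma image_power_collapse (S : signature) (V : algebra S -> Prop) n
    (A B : algebra S) (theta : relation B) (phi : B -> A) x y :
    cong_n_permutable n.*2.+1 V -> V B -> is_congruence theta -> is_hom phi ->
    alt_comp n.+1 (rel_image phi theta) (rel_image phi theta) x y ->
  alt_comp n (rel_image phi theta) (rel_image phi theta) x y.
Proof.
move=> perm VB ctheta /kernel_congruence ckappa lift.
have [b [c [<- <- bc]]] := image_power_lift lift.
by apply: image_power_push; exact/(perm B VB theta _ ctheta ckappa).
Qed.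

(** The tolerance [comp_meet alpha beta] is large enough to contain both
    congruences, yet its n-th power only reaches alternating products with n+1
    factors. Collapsing its powers therefore bounds the length of the products
    of [alpha] and [beta] themselves. *)
Lemma TImC_halves_permutability (S : signature) (V : algebra S -> Prop) n :
  TImC V -> cong_n_permutable n.*2.+1 V -> cong_n_permutable n.+1 V.
Proof.
move=> imV perm A VA.
suff sub (alpha beta : relation A) x y : is_congruence alpha ->
    is_congruence beta ->
  alt_comp n.+1 alpha beta x y -> alt_comp n.+1 beta alpha x y.
  by move=> alpha beta ca cb x y; split; exact: sub.
move=> ca cb abxy; case: (ca) (cb) => [ea _] [eb _].
have [B [theta [phi [VB ctheta homphi tauE]]]] :=
  imV A VA _ (comp_meet_tolerance ca cb).
suff /(comp_meet_power_sub ea eb)[] :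
  alt_comp n (comp_meet alpha beta) (comp_meet alpha beta) x y by [].
have: alt_comp n (rel_image phi theta) (rel_image phi theta) x y.
  apply: image_power_collapse perm VB ctheta homphi _.
  apply: alt_comp_mono abxy => u v uv; apply/tauE.
    by apply: comp_meet_l uv; case: eb.
  by apply: comp_meet_r uv; case: ea.
by apply: alt_comp_mono => u v /tauE.
Qed.

Lemma TImC_cong_permutable (S : signature) (V : algebra S -> Prop) n :
  2 <= n -> TImC V -> cong_n_permutable n V -> cong_permutable V.
Proof.
move=> n_ge2 imV; elim: n n_ge2 => // n IHn; rewrite leq_eqVlt.
case/predU1P=> [<- // | n_ge2 perm]; apply: IHn => //.
case: n n_ge2 perm => // n n_gt0 perm.
apply: TImC_halves_permutability => //; apply: cong_permutable_leq perm.
by rewrite /= !ltnS -addnn -addn1 leq_add2l.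
Qed.

(** * Tolerances in permutable varieties *)

Section RelationAlgebra.
Variables (S : signature) (A : algebra S) (R : relation A).
Hypotheses (reflR : Reflexive R) (compR : compatible R).

Let pair := {p : bool -> A | R (p false) (p true)}.

Lemma rel_algebra_inhabited : inhabited pair.
Proof. by case: (carrier_inhabited A) => a; split; exists (fun=> a). Qed.

(** The pairs are functions on [bool], so that this subalgebra of the square of
    [A] embeds into [product] by a plain projection. *)
Definition rel_algebra : algebra S :=
  @Algebra S pair (fun f a =>
    exist (fun p : bool -> A => R (p false) (p true))
      (fun i => app A f (fun j => sval (a j) i))
      (compR (fun j => svalP (a j))))
    rel_algebra_inhabited.

Lemma rel_algebra_variety (V : algebra S -> Prop) :
  is_variety V -> V A -> V rel_algebra.
Proof.
move=> hV VA.
pose incl (p : rel_algebra) : product (fun _ : bool => A) := sval p.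
apply: (variety_S hV (phi := incl)) => //.
  move=> [p Rp] [q Rq] /= eq_pq; move: Rq; rewrite -{}eq_pq => Rq.
  by congr exist; exact: proof_irrelevance.
exact: variety_P.
Qed.

(** In the algebra of pairs related by [R], the chain [(a, b)], [(b, b)],
    [(b, c)] changes first the left coordinate and then the right one. Changing
    them in the other order passes through [(a, c)]. *)
Lemma permutable_compatible_transitive (V : algebra S -> Prop) :
  is_variety V -> cong_permutable V -> V A -> Transitive R.
Proof.
move=> hV perm VA a b c Rab Rbc.
pose proj i (p : rel_algebra) : A := sval p i.
have cproj i : is_congruence (fun p q => proj i p = proj i q).
  exact: kernel_congruence.
pose mk x y (Rxy : R x y) : rel_algebra :=
  exist _ (fun i : bool => if i then y else x) Rxy.
have linked : alt_comp 2 (fun p q => proj true p = proj true q)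
    (fun p q => proj false p = proj false q) (mk a b Rab) (mk b c Rbc).
  by exists (mk b b (reflR b)) => //; exists (mk b c Rbc).
have [p ap [q pc qE]] : alt_comp 2 (fun p q => proj false p = proj false q)
    (fun p q => proj true p = proj true q) (mk a b Rab) (mk b c Rbc).
  exact/(perm _ (rel_algebra_variety hV VA)).
by move: (svalP p) ap pc; rewrite qE /proj /= => + -> <-.
Qed.

End RelationAlgebra.

Lemma cong_permutable_TImC (S : signature) (V : algebra S -> Prop) :
  is_variety V -> cong_permutable V -> TImC V.
Proof.
move=> hV perm A VA tau [rtau stau ctau].
exists A, tau, id; split=> //.
  by split=> //; split=> //; exact: permutable_compatible_transitive hV perm VA.
by move=> a b; split=> [tab | [_ [_ [? <- <-]]] //]; exists a, b.
Qed.

Theorem theorem5p3 (S : signature) (V : algebra S -> Prop) (n : nat)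
    (hV : is_variety V) (hn : 2 <= n) (hperm : cong_n_permutable n V) :
  TImC V <-> cong_permutable V.
Proof.
split=> [imV | perm]; last exact: cong_permutable_TImC.
exact: TImC_cong_permutable hn imV hperm.
Qed.
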